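(* Suppose $\mathcal{H}=\{H_1,\ldots,H_s\}$ and $\mathcal{H}'=\{H_1',\ldots,H_s'\}$ are two combinatorially equivalent hyperplane arrangements, and let $X=\bigcup H_i$ and $Y=\bigcup H_i'$ be the corresponding unions of hyperplanes. Then there exists a canonical homotopy equivalence $f\colon X\to Y$.
   Context: A hyperplane arrangement $\mathcal{H}=\{H_1,\ldots,H_s\}$ is a finite collection of affine hyperplanes in a real vector space $L\simeq\mathbb{R}^n$, indexed by $\{1,\ldots,s\}$. Its nerve $K_{\mathcal{H}}$ is the simplicial complex on $s$ vertices $v_1,\ldots,v_s$ such that a set of vertices $v_{i_1},\ldots,v_{i_k}$ defines a simplex in $K_{\mathcal{H}}$ if and only if the intersection $H_{i_1}\cap\cdots\cap H_{i_k}$ is not empty. Two hyperplane arrangements $\mathcal{H}_1$ and $\mathcal{H}_2$ are combinatorially equivalent if the corresponding nerves $K_{\mathcal{H}_1}$ and $K_{\mathcal{H}_2}$ are isomorphic. *)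

(* Defs.v *)
From HB Require Import structures.
From mathcomp Require Export all_boot all_order all_algebra.
From mathcomp Require Export all_classical all_reals all_analysis.

Set Implicit Arguments.
Unset Strict Implicit.
Unset Printing Implicit Defensive.

Export Order.TTheory GRing.Theory Num.Theory.
Export numFieldNormedType.Exports.

#[global] Open Scope classical_set_scope.
#[global] Open Scope ring_scope.

(* The empty set counts as a simplex of any complex that has a vertex; this
   does not affect the isomorphisms between complexes. *)
Record simplicialComplex (V : finType) := SimplicialComplex {
  simplices :> set {set V} ;
  simplex_vertex : forall v : V, simplices [set v]%SET ;
  simplex_face : forall I J : {set V},
    I \subset J -> simplices J -> simplices I }.

Definition simplicial_isomorphism (V V' : finType) (K : simplicialComplex V)
    (K' : simplicialComplex V') (phi : V -> V') : Prop :=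
  bijective phi /\
  forall I : {set V}, simplices K I <-> simplices K' (phi @: I)%SET.

Definition affine_hyperplane (R : realType) (n : nat) (A : set 'rV[R]_n)
    : Prop :=
  exists (a : 'cV[R]_n) (b : R), a != 0 /\ A = [set x | (x *m a) 0 0 = b].

(* A family, not a set: the hyperplanes are indexed by 'I_s and repetitions
   are allowed. *)
Record arrangement (R : realType) (n s : nat) := Arrangement {
  hyperplane :> 'I_s -> set 'rV[R]_n ;
  hyperplaneP : forall i, affine_hyperplane (hyperplane i) }.

Section Nerve.
Variables (R : realType) (n s : nat) (H : arrangement R n s).

Definition nerve_simplices : set {set 'I_s} :=
  [set I | (\bigcap_(i in [set` I]) H i) !=set0].

Lemma affine_hyperplane_neq0 (A : set 'rV[R]_n) :
  affine_hyperplane A -> A !=set0.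
Proof.
move=> [a [b [a0 ->]]].
have /existsP[j aj0] : [exists j, a j 0 != 0].
  apply: contraNT a0; rewrite negb_exists => /forallP a0.
  apply/eqP/matrixP => j k; rewrite ord1 mxE.
  by have := a0 j; rewrite negbK => /eqP.
exists ((b / a j 0) *: delta_mx 0 j) => /=.
by rewrite -scalemxAl -rowE !mxE divfK.
Qed.

Lemma nerve_vertex (i : 'I_s) : nerve_simplices [set i]%SET.
Proof.
have [x Hx] := affine_hyperplane_neq0 (hyperplaneP H i).
by exists x => j /=; rewrite inE => /eqP ->.
Qed.

Lemma nerve_face (I J : {set 'I_s}) :
  I \subset J -> nerve_simplices J -> nerve_simplices I.
Proof.
by move=> /fintype.subsetP IJ [x Hx]; exists x => i /= /IJ; exact: Hx.
Qed.

Definition nerve : simplicialComplex 'I_s :=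
  SimplicialComplex nerve_vertex nerve_face.

Definition union_hyperplanes : set 'rV[R]_n := \bigcup_i H i.

End Nerve.

Definition combinatorial_equivalence (R : realType) (n n' s : nat)
    (H : arrangement R n s) (H' : arrangement R n' s) (phi : 'I_s -> 'I_s)
    : Prop :=
  simplicial_isomorphism (nerve H) (nerve H') phi.

(* A map from the subspace X of U to the subspace Y of V is encoded by a
   function on all of U, whose values outside X are irrelevant. *)
Definition cont_map (U V : topologicalType) (X : set U) (Y : set V)
    (f : U -> V) : Prop :=
  {within X, continuous f} /\ f @` X `<=` Y.

Definition homotopic (R : realType) (U V : topologicalType) (X : set U)
    (Y : set V) (f g : U -> V) : Prop :=
  exists h : R * U -> V,
    [/\ cont_map ((`[0, 1] : set R) `*` X) Y h,
        forall x, X x -> h (0, x) = f x &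
        forall x, X x -> h (1, x) = g x].

Definition homotopy_equivalence (R : realType) (U V : topologicalType)
    (X : set U) (Y : set V) (f : U -> V) : Prop :=
  cont_map X Y f /\
  exists g : V -> U,
    [/\ cont_map Y X g,
        homotopic R X X (g \o f) id &
        homotopic R Y Y (f \o g) id].

Definition carried_by (R : realType) (n n' s : nat)
    (H : arrangement R n s) (H' : arrangement R n' s) (phi : 'I_s -> 'I_s)
    (f : 'rV[R]_n -> 'rV[R]_n') : Prop :=
  forall i, f @` H i `<=` H' (phi i).

(* Among the continuous maps compatible with the bijection phi of the
   hyperplanes, f is the only one up to homotopy: phi determines the homotopy
   class of f, which involves no choice. *)
Definition canonical_map (R : realType) (n n' s : nat)
    (H : arrangement R n s) (H' : arrangement R n' s) (phi : 'I_s -> 'I_s)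
    (f : 'rV[R]_n -> 'rV[R]_n') : Prop :=
  let X := union_hyperplanes H in
  let Y := union_hyperplanes H' in
  carried_by H H' phi f /\
  forall g : 'rV[R]_n -> 'rV[R]_n',
    cont_map X Y g -> carried_by H H' phi g -> homotopic R X Y f g.

(* Main.v *)
Require Import Defs.

Set Implicit Arguments.
Unset Strict Implicit.
Unset Printing Implicit Defensive.

(** Both halves of the statement rest on one fact: every hyperplane is convex,
    and more generally closed under affine combinations.

    Uniqueness.  Two maps f and g that both send H_i into H'_(phi i) are joined
    by the straight-line homotopy: a point x of X lies on some H_i, so f x and
    g x lie on the convex set H'_(phi i), and the segment between them stays in
    Y ([carried_homotopic]).  The same remark, applied to the two composites and
    the identity, shows that carried maps in opposite directions are mutually
    inverse up to homotopy, as soon as they exist.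

    Existence ([exists_carried_map]).  For each simplex I of the nerve choose a
    point p_I in the intersection of the H'_(phi i), i in I; it exists because
    phi sends simplices to simplices.  Let l_i >= 0 be a continuous function
    vanishing exactly on H_i, and weight p_I by
      w_I(x) = \prod_(i \notin I) l_i(x),
    which is nonzero exactly when every hyperplane through x has its index in I.
    The barycentre f(x) of the points p_I with these weights is defined
    everywhere, since the set I of all hyperplanes through x is a simplex of
    positive weight; and if x is on H_i, every p_I of nonzero weight is on
    H'_(phi i), so f(x) is too. *)

Section AffineHyperplane.
Variables (R : realType) (n : nat) (A : set 'rV[R]_n).
Hypothesis hypA : affine_hyperplane A.

Lemma affine_hyperplane_affine_combination (T : finType) (P : pred T)
    (w : T -> R) (p : T -> 'rV[R]_n) :
  \sum_(t | P t) w t = 1 -> (forall t, P t -> w t != 0 -> A (p t)) ->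
  A (\sum_(t | P t) w t *: p t).
Proof.
have [a [b [_ ->]]] := hypA; move=> w1 Ap /=.
rewrite mulmx_suml summxE -[b]mul1r -w1 mulr_suml.
apply: eq_bigr => t Pt; rewrite -scalemxAl mxE.
by have [->|/(Ap t Pt) /= ->//] := eqVneq (w t) 0; rewrite !mul0r.
Qed.

Lemma affine_hyperplane_segment (t : R) (y z : 'rV[R]_n) :
  A y -> A z -> A ((1 - t) *: y + t *: z).
Proof.
move=> Ay Az.
have := @affine_hyperplane_affine_combination bool xpredT
  (fun c => if c then 1 - t else t) (fun c => if c then y else z).
by rewrite !big_bool /= subrK; apply=> // -[].
Qed.

Lemma affine_hyperplane_zero_locus :
  exists l : 'rV[R]_n -> R,
    [/\ continuous l, forall x, 0 <= l x & forall x, l x = 0 <-> A x].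
Proof.
have [a [b [_ ->]]] := hypA.
have lC : continuous (fun x : 'rV[R]_n => (x *m a) 0 0 - b).
  move=> x; apply: (@cvgB _ _ _ (nbhs x)); last exact: cvg_cst.
  under eq_cvg do rewrite mxE.
  rewrite mxE; apply: (cvg_big add_continuous) => j _.
  apply: (@cvgM _ _ (nbhs x)); last exact: cvg_cst.
  exact: coord_continuous.
exists (fun x => `|(x *m a) 0 0 - b|); split => [x|x|x /=].
- exact: (cvg_norm (lC x)).
- exact: normr_ge0.
- by split=> [/normr0_eq0/subr0_eq|->]; rewrite ?subrr ?normr0.
Qed.

End AffineHyperplane.

(** These weights, once normalized, form a partition of unity adapted to the
    strata of the arrangement: I contributes at x only if x avoids the
    hyperplanes outside I, and the set of all hyperplanes through x does
    contribute. *)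
Lemma arrangement_weights (R : realType) (n s : nat) (H : arrangement R n s) :
  exists w : {set 'I_s} -> 'rV[R]_n -> R,
    [/\ forall I, continuous (w I), forall I x, 0 <= w I x &
        forall I x, w I x != 0 <-> forall i, H i x -> i \in I].
Proof.
have /choice [l lP] i := affine_hyperplane_zero_locus (hyperplaneP H i).
exists (fun (I : {set 'I_s}) x => \prod_(i | i \notin I) l i x).
split=> [I|I x|I x].
- apply: (continuous_big mul_continuous) => i _.
  by have [] := lP i.
- by apply: prodr_ge0 => i _; have [] := lP i.
- split=> [/prodf_neq0 wI i Hix|HI].
    apply: contraT => /wI; have [_ _ l0] := lP i.
    by move/l0 : Hix => ->; rewrite eqxx.
  apply/prodf_neq0 => i; apply: contra => /eqP lx0.
  by have [_ _ l0] := lP i; apply/HI/l0.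
Qed.

(** Stated for simplicial maps, so that it serves for an isomorphism and for its
    inverse alike. On H_i the map f is an affine combination of the points p_I
    with i in I, and all of them lie on H'_(phi i). *)
Lemma exists_carried_map (R : realType) (n n' s : nat)
    (H : arrangement R n s) (H' : arrangement R n' s) (phi : 'I_s -> 'I_s) :
  (forall I : {set 'I_s},
    nerve_simplices H I -> nerve_simplices H' (phi @: I)%SET) ->
  exists2 f : 'rV[R]_n -> 'rV[R]_n', continuous f & carried_by H H' phi f.
Proof.
move=> phiS.
have [w [w_cont w_ge0 wP]] := arrangement_weights H.
have /choice [p pP] (I : {set 'I_s}) : exists y : 'rV[R]_n',
    nerve_simplices H I -> forall i, i \in I -> H' (phi i) y.
  have [/phiS[y Hy]|nHI] := pselect (nerve_simplices H I); last by exists 0.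
  by exists y => _ i iI; apply: Hy => /=; exact: imset_f.
pose S (I : {set 'I_s}) := `[< nerve_simplices H I >].
pose W x := \sum_(I | S I) w I x.
have W_neq0 x : W x != 0.
  (* The indices of all hyperplanes through x; empty when x is off X. *)
  pose J := [set i | `[< H i x >]]%SET.
  have SJ : S J by apply/asboolP; exists x => i /=; rewrite inE => /asboolP.
  have wJ : w J x != 0 by apply/wP => i Hix; rewrite inE; exact/asboolP.
  rewrite gt_eqF // /W (bigD1 J) //= ltr_wpDr ?sumr_ge0 //.
  by rewrite lt_def wJ w_ge0.
exists (fun x => \sum_(I | S I) (w I x / W x) *: p I).
  apply: (continuous_big add_continuous) => I _ x.
  apply: (@cvgZ _ _ _ (nbhs x)); last exact: cvg_cst.
  apply: (@cvgM _ _ (nbhs x)); first exact: w_cont.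
  apply: (@cvgV _ _ (nbhs x)) => //.
  apply: (continuous_big add_continuous) => J _.
  exact: w_cont.
move=> i _ [x Hix <-].
apply: (affine_hyperplane_affine_combination (hyperplaneP H' (phi i))).
  by rewrite -mulr_suml; exact: divff (W_neq0 x).
move=> I /asboolP SI; rewrite mulf_eq0 negb_or => /andP[/wP wI _].
by apply: pP => //; exact: wI.
Qed.

(** The straight-line homotopy stays in Y, convex or not, because f x
    and g x always share a hyperplane. *)
Lemma carried_homotopic (R : realType) (n n' s : nat)
    (H : arrangement R n s) (H' : arrangement R n' s) (phi : 'I_s -> 'I_s)
    (f g : 'rV[R]_n -> 'rV[R]_n') :
  let X := union_hyperplanes H in
  let Y := union_hyperplanes H' in
  {within X, continuous f} -> {within X, continuous g} ->
  carried_by H H' phi f -> carried_by H H' phi g -> homotopic R X Y f g.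
Proof.
move=> X Y /subspace_continuousP fC /subspace_continuousP gC fH gH.
exists (fun z => (1 - z.1) *: f z.2 + z.1 *: g z.2); split=> [|x _|x _] /=.
- split; last first.
    move=> _ [[t x] [/= _ [i _ Hix]] <-]; exists (phi i) => //=.
    apply: affine_hyperplane_segment; first exact: hyperplaneP.
      by apply: fH; exists x.
    by apply: gH; exists x.
  apply/subspace_continuousP => -[t x] [/= tI Xx].
  set F := within _ _.
  have F1 : z.1 @[z --> F] --> t.
    move=> B tB; apply: (filterS (F := nbhs (t, x))) (cvg_fst tB).
    by move=> z Bz _.
  have F2 : z.2 @[z --> F] --> within X (nbhs x).
    move=> B wB; have {}wB : nbhs x [set y | X y -> B y] := wB.
    apply: (filterS (F := nbhs (t, x))) (cvg_snd wB).
    by move=> -[u y] /= yB [_ Xy]; exact: yB.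
  have Ff : f z.2 @[z --> F] --> f x by apply: cvg_comp F2 (fC x Xx).
  have Fg : g z.2 @[z --> F] --> g x by apply: cvg_comp F2 (gC x Xx).
  apply: cvgD; apply: cvgZ => //.
  by apply: cvgB => //; exact: cvg_cst.
- by rewrite subr0 scale1r scale0r addr0.
- by rewrite subrr scale0r scale1r add0r.
Qed.

Lemma carried_by_union (R : realType) (n n' s : nat)
    (H : arrangement R n s) (H' : arrangement R n' s) (phi : 'I_s -> 'I_s)
    (f : 'rV[R]_n -> 'rV[R]_n') :
  carried_by H H' phi f ->
  f @` union_hyperplanes H `<=` union_hyperplanes H'.
Proof.
by move=> fH _ [x [i _ Hix] <-]; exists (phi i) => //; apply: fH; exists x.
Qed.

Lemma carried_by_comp_id (R : realType) (n n' s : nat)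
    (H : arrangement R n s) (H' : arrangement R n' s) (phi psi : 'I_s -> 'I_s)
    (f : 'rV[R]_n -> 'rV[R]_n') (g : 'rV[R]_n' -> 'rV[R]_n) :
  carried_by H H' phi f -> carried_by H' H psi g -> cancel phi psi ->
  carried_by H H id (g \o f).
Proof.
move=> fH gH phiK i _ [x Hix <-]; rewrite -[i in H (id i)]phiK.
by apply: gH; exists (f x) => //; apply: fH; exists x.
Qed.

Theorem theorem4p8 (R : realType) (n n' s : nat)
    (H : arrangement R n s) (H' : arrangement R n' s) (phi : 'I_s -> 'I_s)
    (Hphi : combinatorial_equivalence H H' phi) :
  exists f : 'rV[R]_n -> 'rV[R]_n',
    homotopy_equivalence R (union_hyperplanes H) (union_hyperplanes H') f /\
    canonical_map H H' phi f.
Proof.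
have [[psi phiK psiK] phiS] := Hphi.
have [f fC fH] := exists_carried_map (fun I => (phiS I).1).
have psiS (I : {set 'I_s}) :
    nerve_simplices H' I -> nerve_simplices H (psi @: I)%SET.
  by move=> SI; apply/phiS; rewrite -imset_comp (eq_imset _ psiK) imset_id.
have [g gC gH] := exists_carried_map psiS.
have id_carried m (K : arrangement R m s) : carried_by K K id id.
  by move=> i _ [x Hix <-].
exists f; split; last first.
  split=> // g' [g'C _] g'H; apply: carried_homotopic fH g'H => //.
  exact: continuous_subspaceT.
split; first by split; [exact: continuous_subspaceT|exact: carried_by_union fH].
exists g; split.
- by split; [exact: continuous_subspaceT|exact: carried_by_union gH].
- apply: carried_homotopic (carried_by_comp_id fH gH phiK) (id_carried _ H).
    apply: continuous_subspaceT => x.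
    by apply: continuous_comp; [exact: fC|exact: gC].
  by apply: continuous_subspaceT => x.
- apply: carried_homotopic (carried_by_comp_id gH fH psiK) (id_carried _ H').
    apply: continuous_subspaceT => x.
    by apply: continuous_comp; [exact: gC|exact: fC].
  by apply: continuous_subspaceT => x.
Qed.
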